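(* Consider the general dynamical system $$\partial_t M+(u\cdot\nabla)M+M^2=\nabla F$$ for an $n\times n$ matrix field $M=M(x,t)$, $x\in\mathbb{R}^n$, associated with an arbitrary velocity field $u$ and forcing $F$. Let $\lambda(M)$ be a (possibly complex) eigenvalue of $M$ associated with corresponding left (right) eigenvector $l$ ($r$). Then the dynamics of $\lambda(M)$ is governed by the corresponding Riccati-like equation $$\partial_t\lambda+u\cdot\nabla\lambda+\lambda^2=\langle l,\nabla F\, r\rangle .$$
   Context: $M=\nabla u$ is the velocity gradient field of the equation $\partial_t u+u\cdot\nabla u=F$. Left and right eigenvectors: $lM=\lambda l$ ($l$ a row vector), $Mr=\lambda r$ ($r$ a column vector). $(u\cdot\nabla)M=\sum_j u_j\partial_jM$ is taken entrywise, $\nabla F$ is the matrix of spatial derivatives of the forcing $F$, and $\langle l,\nabla F\,r\rangle=l(\nabla F)r$. (The statement as printed mentions no normalization of the eigenvectors; the paper's proof works with $l,r$ normalized so that $lr=1$.)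
   Formalization: The eigenvectors are assumed normalized, lr = 1, and continuous in (x,t) on an open space-time region where the system holds; the equation fails without normalization (replace l by 2l) or for discontinuous choices at an eigenvalue crossing. Differentiability of the eigenvalue is proved. *)

(* Defs.v *)
From HB Require Import structures.
From mathcomp Require Import all_boot all_order all_algebra.
From mathcomp Require Import complex.
From mathcomp Require Import all_classical all_reals all_analysis.

Set Implicit Arguments.
Unset Strict Implicit.
Unset Printing Implicit Defensive.

Import Order.TTheory GRing.Theory Num.Theory.
Import numFieldNormedType.Exports.

Local Open Scope classical_set_scope.
Local Open Scope ring_scope.
Local Open Scope complex_scope.

Section Defs.
Variables (R : realType) (n : nat).

Definition st_field (T : Type) := 'cV[R]_n -> R -> T.

Definition basis_vec (j : 'I_n) : 'cV[R]_n := delta_mx j ord0.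

Definition has_dt (f : st_field R) x t := derivable (f x) t 1.
Definition has_dx j (f : st_field R) x t :=
  derivable (fun y => f y t) x (basis_vec j).

Definition dt (f : st_field R) x t : R := derive1 (f x) t.
Definition dx j (f : st_field R) x t : R := 'D_(basis_vec j) (fun y => f y t) x.

(* [derive] needs values in a normed module over R, which R[i] is not in the
   libraries; derivatives and continuity of a complex-valued function of real
   variables are those of its real and imaginary parts. *)
Definition Re_field (f : st_field R[i]) : st_field R := fun x t => complex.Re (f x t).
Definition Im_field (f : st_field R[i]) : st_field R := fun x t => complex.Im (f x t).

Definition has_dtC (f : st_field R[i]) x t :=
  has_dt (Re_field f) x t /\ has_dt (Im_field f) x t.
Definition has_dxC j (f : st_field R[i]) x t :=
  has_dx j (Re_field f) x t /\ has_dx j (Im_field f) x t.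

Definition dtC (f : st_field R[i]) x t : R[i] :=
  dt (Re_field f) x t +i* dt (Im_field f) x t.
Definition dxC j (f : st_field R[i]) x t : R[i] :=
  dx j (Re_field f) x t +i* dx j (Im_field f) x t.

Definition continuousC_at (f : st_field R[i]) x t :=
  {for (x, t), continuous (fun p : 'cV[R]_n * R => Re_field f p.1 p.2)} /\
  {for (x, t), continuous (fun p : 'cV[R]_n * R => Im_field f p.1 p.2)}.

Definition continuous_mxC_at p q (A : st_field 'M[R[i]]_(p, q)) x t :=
  forall i j, continuousC_at (fun y s => A y s i j) x t.

Definition has_dt_mx (M : st_field 'M[R]_n) x t :=
  forall i k, has_dt (fun y s => M y s i k) x t.
Definition has_dx_mx (M : st_field 'M[R]_n) x t :=
  forall j i k, has_dx j (fun y s => M y s i k) x t.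

Definition dt_mx (M : st_field 'M[R]_n) x t : 'M[R]_n :=
  \matrix_(i, k) dt (fun y s => M y s i k) x t.
Definition dx_mx j (M : st_field 'M[R]_n) x t : 'M[R]_n :=
  \matrix_(i, k) dx j (fun y s => M y s i k) x t.

Definition advect_mx (u : st_field 'cV[R]_n) (M : st_field 'M[R]_n) x t : 'M[R]_n :=
  \sum_j u x t j ord0 *: dx_mx j M x t.

Definition advectC (u : st_field 'cV[R]_n) (f : st_field R[i]) x t : R[i] :=
  \sum_j (u x t j ord0)%:C * dxC j f x t.

Definition has_grad (F : st_field 'cV[R]_n) x t :=
  forall i j, has_dx j (fun y s => F y s i ord0) x t.

(* (grad F)_ij = d_j F_i: with this convention M = grad u satisfies the
   system with M^2 = M *m M when dt u + u . grad u = F. *)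
Definition grad (F : st_field 'cV[R]_n) x t : 'M[R]_n :=
  \matrix_(i, j) dx j (fun y s => F y s i ord0) x t.

Definition mxC (A : 'M[R]_n) : 'M[R[i]]_n := map_mx (real_complex R) A.

Definition left_eigenvector (A : 'M[R]_n) (a : R[i]) (l : 'rV[R[i]]_n) :=
  l != 0 /\ l *m mxC A = a *: l.
Definition right_eigenvector (A : 'M[R]_n) (a : R[i]) (r : 'cV[R[i]]_n) :=
  r != 0 /\ mxC A *m r = a *: r.

(* <l, A r> = l A r: no complex conjugation *)
Definition pairing (l : 'rV[R[i]]_n) (A : 'M[R]_n) (r : 'cV[R[i]]_n) : R[i] :=
  (l *m (mxC A *m r)) ord0 ord0.

End Defs.

(* Main.v *)
Require Import Defs.
From HB Require Import structures.
From mathcomp Require Import all_boot all_order all_algebra.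
From mathcomp Require Import complex.
From mathcomp Require Import all_classical all_reals all_analysis.
Import Order.TTheory GRing.Theory Num.Theory.
Import numFieldNormedType.Exports.
Local Open Scope classical_set_scope.
Local Open Scope ring_scope.
Local Open Scope complex_scope.

(** Freeze the left eigenvector [l] at the base point and let everything else
    vary along a line with parameter [h]. Since [l M_0 = lambda_0 l] and
    [M_h r_h = lambda_h r_h],
      [(lambda_h - lambda_0) / h * (l r_h) = l ((M_h - M_0) / h) r_h],
    and [l r_h --> l r_0 = 1] by continuity of [r]. Hence [lambda] has the
    directional derivative [l M' r] although [l] and [r] are merely continuous.
    Pairing the matrix equation with [l] and [r] then gives the Riccati
    equation, because [l M^2 r = lambda^2]. *)

Section ComplexLimits.
Variables (R : realType) (T : Type) (F : set_system T).
Context {FF : Filter F}.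
Implicit Types (f g : T -> R[i]) (a b : R[i]).

(** Convergence is taken on real and imaginary parts separately, so that it connects directly with
    [continuousC_at], [has_dtC] and [has_dxC], which are defined in the same way. *)
Definition cvgC f a :=
  (complex.Re (f h) @[h --> F] --> complex.Re a) /\
  (complex.Im (f h) @[h --> F] --> complex.Im a).

Lemma cvgC_cst a : cvgC (fun=> a) a.
Proof. by split; exact: cvg_cst. Qed.

Lemma cvgC_real (f : T -> R) (a : R) :
  f h @[h --> F] --> a -> cvgC (fun h => (f h)%:C) a%:C.
Proof. by split => //; exact: cvg_cst. Qed.

Lemma cvgC_add f g a b : cvgC f a -> cvgC g b -> cvgC (fun h => f h + g h) (a + b).
Proof.
move=> [fa1 fa2] [gb1 gb2]; split; rewrite raddfD /=.
- by under eq_fun do rewrite raddfD; exact: cvgD.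
- by under eq_fun do rewrite raddfD; exact: cvgD.
Qed.

Lemma ReM (z w : R[i]) : complex.Re (z * w) =
  complex.Re z * complex.Re w - complex.Im z * complex.Im w.
Proof. by case: z w => [? ?] [? ?]. Qed.

Lemma ImM (z w : R[i]) : complex.Im (z * w) =
  complex.Re z * complex.Im w + complex.Im z * complex.Re w.
Proof. by case: z w => [? ?] [? ?]. Qed.

Lemma cvgC_mul f g a b : cvgC f a -> cvgC g b -> cvgC (fun h => f h * g h) (a * b).
Proof.
move=> [fa1 fa2] [gb1 gb2]; split.
- by rewrite ReM; under eq_fun do rewrite ReM; apply: cvgB; exact: cvgM.
- by rewrite ImM; under eq_fun do rewrite ImM; apply: cvgD; exact: cvgM.
Qed.

Lemma cvgC_sum (I : Type) (s : seq I) (f : I -> T -> R[i]) (a : I -> R[i]) :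
  (forall i, cvgC (f i) (a i)) ->
  cvgC (fun h => \sum_(i <- s) f i h) (\sum_(i <- s) a i).
Proof.
move=> fa; elim: s => [|i s IHs].
  rewrite big_nil (_ : (fun h => _) = fun=> 0); first exact: cvgC_cst.
  by apply/funext => h; rewrite big_nil.
rewrite big_cons (_ : (fun h => _) = fun h => f i h + \sum_(j <- s) f j h).
  exact: cvgC_add.
by apply/funext => h; rewrite big_cons.
Qed.

(** The parts of [z^-1] are [Re z / |z|^2] and [- Im z / |z|^2], so real limits suffice once [|a|^2]
    is nonzero; a sum of two real squares vanishes only if both do. *)
Lemma cvgC_inv f a : a != 0 -> cvgC f a -> cvgC (fun h => (f h)^-1) a^-1.
Proof.
move=> a0 [fa1 fa2].
pose nrm (z : R[i]) := complex.Re z ^+ 2 + complex.Im z ^+ 2.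
have nrma : nrm a != 0.
  move: a0; case: (a) => x y; rewrite /nrm /=.
  rewrite paddr_eq0 ?sqr_ge0// !sqrf_eq0.
  by apply: contra => /andP[/eqP-> /eqP->].
have fn : nrm (f h) @[h --> F] --> nrm a.
  by rewrite /nrm; apply: cvgD; under eq_fun do rewrite expr2; exact: cvgM.
have ReV (z : R[i]) : complex.Re z^-1 = complex.Re z * (nrm z)^-1 by case: z.
have ImV (z : R[i]) : complex.Im z^-1 = - (complex.Im z * (nrm z)^-1) by case: z.
split.
- by rewrite ReV; under eq_fun do rewrite ReV; apply: cvgM => //; exact: cvgV.
- rewrite ImV; under eq_fun do rewrite ImV.
  by apply: cvgN; apply: cvgM => //; exact: cvgV.
Qed.

Lemma cvgC_near_eq f g a :
  (\forall h \near F, f h = g h) -> cvgC f a -> cvgC g a.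
Proof.
move=> fg [fa1 fa2]; split; [apply: cvg_trans fa1|apply: cvg_trans fa2];
  by apply: near_eq_cvg; near do congr (_ _).
Unshelve. all: by end_near. Qed.

Lemma cvgC_mulmx (p q s : nat) (A : T -> 'M[R[i]]_(p, q)) (B : T -> 'M[R[i]]_(q, s))
    (A0 : 'M[R[i]]_(p, q)) (B0 : 'M[R[i]]_(q, s)) :
  (forall i j, cvgC (fun h => A h i j) (A0 i j)) ->
  (forall i j, cvgC (fun h => B h i j) (B0 i j)) ->
  forall i j, cvgC (fun h => (A h *m B h) i j) ((A0 *m B0) i j).
Proof.
move=> AA0 BB0 i j; rewrite mxE.
rewrite (_ : (fun h => _) = fun h => \sum_k A h i k * B h k j).
  by apply: cvgC_sum => k; exact: cvgC_mul.
by apply/funext => h; rewrite mxE.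
Qed.

End ComplexLimits.
Arguments cvgC {R T} F f a.
Arguments cvgC_mulmx {R T F FF p q s A B A0 B0}.

Section EigenvalueDerivative.
Variables (R : realType) (n : nat).

Lemma pairingD (l : 'rV[R[i]]_n) (A B : 'M[R]_n) (r : 'cV[R[i]]_n) :
  pairing l (A + B) r = pairing l A r + pairing l B r.
Proof. by rewrite /pairing /mxC map_mxD mulmxDl mulmxDr mxE. Qed.

Lemma pairingZ (l : 'rV[R[i]]_n) (c : R) (A : 'M[R]_n) (r : 'cV[R[i]]_n) :
  pairing l (c *: A) r = c%:C * pairing l A r.
Proof. by rewrite /pairing /mxC map_mxZ -scalemxAl -scalemxAr mxE. Qed.

Lemma pairing_sum (I : Type) (s : seq I) (l : 'rV[R[i]]_n) (A : I -> 'M[R]_n)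
    (r : 'cV[R[i]]_n) :
  pairing l (\sum_(i <- s) A i) r = \sum_(i <- s) pairing l (A i) r.
Proof.
apply: (big_morph (fun B => pairing l B r)) => [A1 A2|]; first exact: pairingD.
by rewrite /pairing /mxC map_mx0 mul0mx mulmx0 mxE.
Qed.

(** The domain [V] is left general so that one argument covers both the time derivative ([V = R],
    [v = 1]) and each space derivative ([V = 'cV[R]_n], [v] a basis vector). *)
Lemma eigenvalue_derive (V : normedModType R) (A : V -> 'M[R]_n)
    (la : V -> R[i]) (r : V -> 'cV[R[i]]_n) (l : 'rV[R[i]]_n) (x v : V) :
  (forall i k, derivable (fun y => A y i k) x v) ->
  l *m mxC (A x) = la x *: l ->
  (\forall y \near x, mxC (A y) *m r y = la y *: r y) ->
  l *m r x = 1%:M ->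
  (forall i, cvgC (nbhs x) (fun y => r y i ord0) (r x i ord0)) ->
  [/\ derivable (fun y => complex.Re (la y)) x v,
      derivable (fun y => complex.Im (la y)) x v
    & 'D_v (fun y => complex.Re (la y)) x +i* 'D_v (fun y => complex.Im (la y)) x
      = pairing l (\matrix_(i, k) 'D_v (fun y => A y i k) x) (r x)].
Proof.
move=> dA lA Ar lr rC.
set A' := (X in pairing _ X _).
(* This transports whatever holds or converges near [x] to the punctured neighbourhood of 0 over
   which directional derivatives are taken. *)
have line : h *: v + x @[h --> (0 : R)^'] --> x.
  have at0 : h *: v + x @[h --> (0 : R)] --> 0 *: v + x.
    apply: cvgD; last exact: cvg_cst.
    by apply: cvgZr_tmp; exact: cvg_id.
  rewrite scale0r add0r in at0.
  by apply: cvg_trans at0 => S; exact: nbhs_dnbhs.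
pose y h := h *: v + x.
pose dq h := \matrix_(i, k) (h^-1 * (A (y h) i k - A x i k)).
have dqA' i k : cvgC (0 : R)^' (fun h => mxC (dq h) i k) (mxC A' i k).
  rewrite !mxE; rewrite (_ : (fun h => _) =
      fun h => (h^-1 * (A (y h) i k - A x i k))%:C); last first.
    by apply/funext => h; rewrite !mxE.
  by apply: cvgC_real; exact: dA.
have rC' i j : cvgC (0 : R)^' (fun h => r (y h) i j) (r x i j).
  rewrite ord1; have [rRe rIm] := rC i.
  by split; [exact: cvg_comp rRe|exact: cvg_comp rIm].
have lC i j : cvgC (0 : R)^' (fun=> l i j) (l i j) by exact: cvgC_cst.
have pC : cvgC (0 : R)^' (fun h => pairing l (dq h) (r (y h))) (pairing l A' (r x)).
  apply: (cvgC_mulmx (A := fun=> l)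
    (B := fun h => mxC (dq h) *m r (y h))) => // i j.
  exact: (cvgC_mulmx (A := fun h => mxC (dq h)) (B := fun h => r (y h))).
have lrC : cvgC (0 : R)^' (fun h => (l *m r (y h)) ord0 ord0) 1.
  have -> : 1 = (l *m r x) ord0 ord0 by rewrite lr mxE.
  exact: (cvgC_mulmx (A := fun=> l) (B := fun h => r (y h))).
(* The scalar [l r(y h)] tends to 1, so its real part is eventually nonzero and it can be divided
   by. *)
have lr0 : \forall h \near (0 : R)^', (l *m r (y h)) ord0 ord0 != 0.
  have [lr1 _] := lrC.
  have : \forall h \near (0 : R)^', complex.Re ((l *m r (y h)) ord0 ord0) != 0.
    by apply: (cvgr_neq0 _ lr1); rewrite oner_neq0.
  by apply: filterS => h; apply: contra_neq => ->.
have Ary : \forall h \near (0 : R)^', mxC (A (y h)) *m r (y h) = la (y h) *: r (y h).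
  exact: line Ar.
have quotient : \forall h \near (0 : R)^',
    pairing l (dq h) (r (y h)) * ((l *m r (y h)) ord0 ord0)^-1 =
    (h^-1)%:C * (la (y h) - la x).
  near=> h.
  have w0 : (l *m r (y h)) ord0 ord0 != 0 by near: h.
  have Ay : mxC (A (y h)) *m r (y h) = la (y h) *: r (y h) by near: h.
  have -> : dq h = h^-1 *: (A (y h) - A x) by apply/matrixP => i k; rewrite !mxE.
  (* The difference splits: [A (y h)] acts to the right on its eigenvector [r (y h)], while [A x]
     acts to the left on [l]. Both terms become multiples of [l r(y h)], which then cancels. *)
  rewrite pairingZ /pairing /mxC map_mxB mulmxBl mulmxBr [_ (A (y h))]/(mxC _) Ay.
  rewrite mulmxA lA -scalemxAr -scalemxAl -scalerBl [fun_of_matrix (_ *: _) _ _]mxE mulrA.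
  by rewrite mulfK.
have laC : cvgC (0 : R)^' (fun h => (h^-1)%:C * (la (y h) - la x)) (pairing l A' (r x)).
  (* The factor [1^-1] is inserted as the limit of [(l r(y h))^-1]. *)
  apply: cvgC_near_eq quotient _; rewrite -[pairing _ A' _]mulr1 -[X in _ * X]invr1.
  by apply: cvgC_mul => //; apply: cvgC_inv => //; exact: oner_neq0.
have [laRe laIm] := laC.
(* Since [h^-1] is real, taking real or imaginary parts commutes with the difference quotient. *)
have dRe : h^-1 *: (complex.Re (la (y h)) - complex.Re (la x)) @[h --> (0 : R)^']
    --> complex.Re (pairing l A' (r x)).
  apply: cvg_trans laRe; apply: near_eq_cvg; near=> h.
  by case: (la (y h)) (la x) => [a b] [c d] /=; rewrite mul0r subr0.
have dIm : h^-1 *: (complex.Im (la (y h)) - complex.Im (la x)) @[h --> (0 : R)^']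
    --> complex.Im (pairing l A' (r x)).
  apply: cvg_trans laIm; apply: near_eq_cvg; near=> h.
  by case: (la (y h)) (la x) => [a b] [c d] /=; rewrite mul0r addr0.
split; [by apply/cvg_ex; eexists; exact: dRe|by apply/cvg_ex; eexists; exact: dIm|].
rewrite /derive (cvg_lim _ dRe)// (cvg_lim _ dIm)//.
by case: (pairing _ _ _).
Unshelve. all: by end_near. Qed.

End EigenvalueDerivative.

Theorem lemma3p1 (R : realType) (n : nat)
    (D : set ('cV[R]_n * R)) (D_open : open D)
    (u F : st_field R n 'cV[R]_n) (M : st_field R n 'M[R]_n)
    (F_diff : forall x t, D (x, t) -> has_grad F x t)
    (M_diff : forall x t, D (x, t) -> has_dt_mx M x t /\ has_dx_mx M x t)
    (M_eq : forall x t, D (x, t) ->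
       dt_mx M x t + advect_mx u M x t + M x t *m M x t = grad F x t)
    (lambda : st_field R n R[i])
    (l : st_field R n 'rV[R[i]]_n) (r : st_field R n 'cV[R[i]]_n)
    (l_eig : forall x t, D (x, t) ->
       left_eigenvector (M x t) (lambda x t) (l x t))
    (r_eig : forall x t, D (x, t) ->
       right_eigenvector (M x t) (lambda x t) (r x t))
    (lr_normalized : forall x t, D (x, t) -> l x t *m r x t = 1%:M)
    (l_cont : forall x t, D (x, t) -> continuous_mxC_at l x t)
    (r_cont : forall x t, D (x, t) -> continuous_mxC_at r x t) :
  forall x t, D (x, t) ->
    [/\ has_dtC lambda x t,
        forall j, has_dxC j lambda x t
      & dtC lambda x t + advectC u lambda x t + lambda x t ^+ 2
        = pairing (l x t) (grad F x t) (r x t)].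

Proof.
move=> x t Dxt.
have [_ lM] := l_eig x t Dxt.
have [_ rM] := r_eig x t Dxt.
have [Mt Mx] := M_diff x t Dxt.
have nearD : \forall p \near (x, t), D p by exact: open_nbhs_nbhs.
(* Openness of [D] and joint continuity of [r] are restricted to the time and space slices through
   [(x, t)]. *)
have to_time : (x, s) @[s --> t] --> (x, t).
  exact: (cvg_pair (f := fun=> x) (g := id) (cvg_cst x) cvg_id).
have to_space : (y, t) @[y --> x] --> (x, t).
  apply: (@cvg_pair _ _ _ (nbhs x) (nbhs x) (nbhs t) _ _ _ id (fun=> t)).
    exact: cvg_id.
  exact: cvg_cst.
have [dtRe dtIm dtE] : [/\ derivable (Re_field lambda x) t 1,
    derivable (Im_field lambda x) t 1
  & dtC lambda x t = pairing (l x t) (dt_mx M x t) (r x t)].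
  (* Time derivatives are recast as directional derivatives along 1, the form used by
     [eigenvalue_derive]. *)
  rewrite /dtC /dt !derive1E (_ : dt_mx M x t =
    \matrix_(i, k) 'D_1 (fun s => M x s i k) t); last first.
    by apply/matrixP => i k; rewrite !mxE /dt derive1E.
  apply: (@eigenvalue_derive R n R (M x) (lambda x) (r x) (l x t) t 1) => //.
  - have Dt : \forall s \near t, D (x, s) by exact: to_time nearD.
    apply: filterS Dt => s Ds.
    by have [] := r_eig x s Ds.
  - exact: lr_normalized.
  - move=> i; have [rRe rIm] := r_cont x t Dxt i ord0.
    by split; [exact: cvg_comp to_time rRe|exact: cvg_comp to_time rIm].
have dxE j : [/\ has_dx j (Re_field lambda) x t, has_dx j (Im_field lambda) x t
  & dxC j lambda x t = pairing (l x t) (dx_mx j M x t) (r x t)].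
  apply: (@eigenvalue_derive R n 'cV[R]_n (M^~ t) (lambda^~ t) (r^~ t)
    (l x t) x (basis_vec R j)) => //.
  - exact: Mx.
  - have Dx : \forall y \near x, D (y, t) by exact: to_space nearD.
    apply: filterS Dx => y Dy.
    by have [] := r_eig y t Dy.
  - exact: lr_normalized.
  - move=> i; have [rRe rIm] := r_cont x t Dxt i ord0.
    by split; [exact: cvg_comp to_space rRe|exact: cvg_comp to_space rIm].
split => [//|j|]; first by have [] := dxE j.
(* With [grad F] replaced by the left side of the system, the pairing splits into three terms that
   match one by one. *)
rewrite -M_eq// !pairingD dtE; congr (_ + _ + _).
- rewrite /advectC /advect_mx pairing_sum; apply: eq_bigr => j _.
  by rewrite pairingZ; have [_ _ ->] := dxE j.
(* Applying the right eigenvector equation twice gives [l M M r = lambda^2 (l r)], and [l r = 1]. *)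
- rewrite /pairing /mxC map_mxM -mulmxA [map_mx _ _ *m r x t]rM -scalemxAr.
  rewrite [map_mx _ _ *m r x t]rM scalerA -scalemxAr lr_normalized//.
  by rewrite !mxE eqxx mulr1 expr2.
Qed.
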